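(* Assume that $0<\alpha\le1$ and $A(v)=(1-v)^{-p}$ with $0<p\le\alpha$, and that $v_L<1$ and $v_\delta<1$. Suppose that $y_L:=u_L-c>0$ and $$B_L:=\rho_L(u_L-c)^2-\frac{A(v_L)}{\rho_L^\alpha}>0.$$ Let $W_L=F(H_L)-cH_L$. Then the reduced system $$\frac{dH}{d\tau}=F(H)-cH-W_L$$ has a trajectory $H_L(\zeta)=(\rho_L(\zeta),u_L(\zeta),v_L(\zeta))$, $-\infty<\zeta<0$ (with $\zeta$ the reparametrized time $d\tau=\rho\,d\zeta$), such that $$H_L(\zeta)\to(\rho_L,u_L,v_L)\quad\text{as }\zeta\to-\infty.$$ Moreover $$\rho_L(\zeta)\to+\infty,\qquad u_L(\zeta)\to c,\qquad v_L(\zeta)\to v_\delta\qquad\text{as }\zeta\to0^-.$$ More precisely, $$u_L(\zeta)-c=-B_L\zeta+o(|\zeta|),\qquad \frac1{\rho_L(\zeta)}=\frac{B_L}2\zeta^2+o(\zeta^2),\qquad v_L(\zeta)-v_\delta=\Gamma_L\zeta+o(|\zeta|)$$ as $\zeta\to0^-$, where, with $W_L=(w_{1,L},w_{2,L},w_{3,L})^T$, $$\Gamma_L=v_\delta w_{1,L}-w_{3,L}=\rho_L(u_L-c)(v_\delta-v_L).$$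
   Context: Here $H=(\rho,\rho u,\rho v)^T$ with $\rho>0$, $F(H)=(\rho u,\ \rho u^2-A(v)\rho^{-\alpha},\ \rho uv)^T$; trajectories are described in the primitive variables $(\rho,u,v)$. $(\rho_L,u_L,v_L)$, $\rho_L>0$, is the left Riemann state and $H_L=(\rho_L,\rho_Lu_L,\rho_Lv_L)^T$. $c$ is the singular-shock speed and $v_\delta$ the associated transported state: for a right state $(\rho_R,u_R,v_R)$ and $[\cdot]=\cdot_R-\cdot_L$, $c$ satisfies $k_1:=c[\rho]-[\rho u]>0$, $c[\rho u]-[\rho u^2-A(v)\rho^{-\alpha}]=ck_1$, and $v_\delta=k_3/k_1$ with $k_3=c[\rho v]-[\rho uv]$. *)

(* Defs.v *)
From Stdlib Require Import Reals.
From Coquelicot Require Export Coquelicot.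
Open Scope R_scope.

(* Conserved variables (rho, rho u, rho v), nested to the left. *)
Definition state : Type := (R * R * R)%type.

Definition conserved (rho u v : R) : state := (rho, rho * u, rho * v).

(* The flux is a function of the conserved state, meaningful for rho > 0;
   u and v are recovered by dividing by rho. *)
Definition flux (A : R -> R) (alpha : R) (H : state) : state :=
  let '(rho, m, n) := H in
  let u := m / rho in
  let v := n / rho in
  (rho * u, rho * u ^ 2 - A v * Rpower rho (- alpha), rho * u * v).

Definition moving_flux (A : R -> R) (alpha c : R) (H : state) : state :=
  minus (flux A alpha H) (scal c H).

Definition reduced_field (A : R -> R) (alpha c : R) (W H : state) : state :=
  minus (moving_flux A alpha c H) W.

(* Main.v *)
Require Import Defs.
From Stdlib Require Import Reals Lra ClassicalEpsilon.
From Coquelicot Require Import Coquelicot.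
Open Scope R_scope.

(** Write [w = w1], [s = 1 / rho], [y = u - c] and [B = BL].  In the time [zeta] the
    reduced system becomes
<<
      s' = w s - y,    y' = w y - B - A(v) s^alpha,    v' = w (v - vL).
>>
    The last equation is solved by [v = vL + (vdelta - vL) exp (w zeta)], which takes
    the value [vdelta] at 0 and stays below 1 for [zeta <= 0].  So [a = A(v)] is a
    known positive coefficient with limit [A vL] at minus infinity, and the trajectory
    is sought as the solution with [s(0) = y(0) = 0], followed backwards in time.

    Existence.  For [sigma = exp (- w zeta) s] the problem reads
    [sigma'' = g + b sigma^alpha], [sigma(0) = sigma'(0) = 0], with [g > 0] and
    [b >= 0].  The power is not Lipschitz at 0, but it is nondecreasing and satisfies
    [phi (k x) <= k phi x] for [k >= 1].  Hence the Picard iterates increase, and since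
    the part [g] of the right-hand side is insensitive to [sigma], the ratio of two
    successive iterates tends to 1 geometrically ([picard_geometric]); their limit is a
    solution ([sublinear_cauchy]), positive away from 0 because [g] is.

    The limit at minus infinity.  The left state [sL = 1 / rhoL], [yL = w sL] is an
    equilibrium: [w^2 sL = B + A(vL) sL^alpha].  The secant inequality
    [|x^alpha - sL^alpha| <= sL^(alpha - 1) |x - sL|] makes the nonlinearity, divided
    by [w^2], a contraction towards it with the constant [1 - B / (w^2 sL) < 1].  So
    the square of the distance to equilibrium decays backwards in time, up to an
    error that vanishes with [a - A vL] ([backward_convergence], [profile_limit]).

    At 0 one has [y'(0) = - B], [s'(0) = 0], [s''(0) = B] and
    [v'(0) = w (vdelta - vL) = GammaL]; the three expansions are the Taylor expansions
    there.  The time [tau] is an antiderivative of [rho = 1 / s]; it is strictly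
    increasing, and composing with its inverse gives the solution [H] as a function of
    [tau] ([time_change]). *)

(** * Iterated integrals from 0 *)

Lemma continuous_locally_bounded (f : R -> R) (hf : forall x, continuous f x) (T : R) :
  exists M, 0 <= M /\ forall t, Rabs t <= T -> f t <= M.
Proof.
  destruct (Rle_lt_dec 0 T) as [hT | hT].
  - destruct (continuity_ab_maj f (- T) T) as [m [hm _]].
    + lra.
    + intros x _. apply continuity_pt_filterlim. apply hf.
    + exists (Rmax 0 (f m)). split; [apply Rmax_l |].
      intros t ht. apply Rle_trans with (f m); [| apply Rmax_r].
      apply hm. now apply Rabs_le_between.
  - exists 0. split; [lra |]. intros t ht. pose proof (Rabs_pos t). lra.
Qed.

Definition integral (f : R -> R) (t : R) : R := RInt f 0 t.
Definition double_integral (f : R -> R) : R -> R := integral (integral f).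

Lemma is_derive_integral (f : R -> R) (hf : forall x, continuous f x) (t : R) :
  is_derive (integral f) t (f t).
Proof.
  apply (is_derive_RInt f (integral f) 0 t); [| apply hf].
  apply filter_forall. intros b. apply (RInt_correct (V := R_CompleteNormedModule)).
  apply (ex_RInt_continuous (V := R_CompleteNormedModule)). intros z _. apply hf.
Qed.

Lemma continuous_integral (f : R -> R) (hf : forall x, continuous f x) (t : R) :
  continuous (integral f) t.
Proof.
  apply (ex_derive_continuous (V := R_NormedModule)). exists (f t).
  now apply is_derive_integral.
Qed.

Lemma integral_0 (f : R -> R) : integral f 0 = 0.
Proof. apply (RInt_point (V := R_CompleteNormedModule)). Qed.

Lemma integral_unique (F f : R -> R) (hF : forall t, is_derive F t (f t))
  (hf : forall x, continuous f x) (t : R) : integral f t = F t - F 0.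
Proof.
  apply (is_RInt_unique (V := R_CompleteNormedModule)).
  apply (is_RInt_derive (V := R_CompleteNormedModule) F f); intros; auto.
Qed.

Lemma integral_ext (f h : R -> R) (t : R) :
  (forall x, f x = h x) -> integral f t = integral h t.
Proof. intros e. apply (RInt_ext (V := R_CompleteNormedModule)). auto. Qed.

Lemma integral_scal (k : R) (f : R -> R) (hf : forall x, continuous f x) (t : R) :
  integral (fun r => k * f r) t = k * integral f t.
Proof.
  apply (RInt_scal (V := R_CompleteNormedModule)).
  apply (ex_RInt_continuous (V := R_CompleteNormedModule)). intros z _. apply hf.
Qed.

Lemma integral_le (f h : R -> R) (hf : forall x, continuous f x)
  (hh : forall x, continuous h x) (T : R)
  (hle : forall r, Rabs r <= T -> f r <= h r) (t : R) (ht : Rabs t <= T) :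
  (0 <= t -> integral f t <= integral h t) /\
  (t <= 0 -> integral h t <= integral f t).
Proof.
  assert (ei : forall k : R -> R, (forall x, continuous k x) -> forall a b, ex_RInt k a b).
  { intros k hk a b. apply (ex_RInt_continuous (V := R_CompleteNormedModule)).
    intros z _. apply hk. }
  apply Rabs_le_between in ht.
  split; intros h0; unfold integral.
  - apply RInt_le; auto.
    intros x hx. apply hle. apply Rabs_le_between. lra.
  - rewrite <- (opp_RInt_swap (V := R_CompleteNormedModule) h t 0) by auto.
    rewrite <- (opp_RInt_swap (V := R_CompleteNormedModule) f t 0) by auto.
    apply Ropp_le_contravar. apply RInt_le; auto.
    intros x hx. apply hle. apply Rabs_le_between. lra.
Qed.

Lemma continuous_double_integral (f : R -> R) (hf : forall x, continuous f x) (t : R) :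
  continuous (double_integral f) t.
Proof. apply continuous_integral. now apply continuous_integral. Qed.

Lemma double_integral_scal (k : R) (f : R -> R) (hf : forall x, continuous f x) (t : R) :
  double_integral (fun r => k * f r) t = k * double_integral f t.
Proof.
  unfold double_integral.
  rewrite <- integral_scal by now apply continuous_integral.
  apply integral_ext. intros x. now apply integral_scal.
Qed.

(** Integrating twice from 0 reverses no inequality, on either side of 0: for
    negative times the two sign changes cancel. *)
Lemma double_integral_le (f h : R -> R) (hf : forall x, continuous f x)
  (hh : forall x, continuous h x) (T : R)
  (hle : forall r, Rabs r <= T -> f r <= h r) (t : R) (ht : Rabs t <= T) :
  double_integral f t <= double_integral h t.
Proof.
  assert (cf := continuous_integral f hf). assert (ch := continuous_integral h hh).
  assert (ei : forall k : R -> R, (forall x, continuous k x) -> forall a b, ex_RInt k a b).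
  { intros k hk a b. apply (ex_RInt_continuous (V := R_CompleteNormedModule)).
    intros z _. apply hk. }
  apply Rabs_le_between in ht.
  unfold double_integral. unfold integral at 1 3.
  destruct (Rle_lt_dec 0 t) as [h0 | h0].
  - apply RInt_le; auto.
    intros x hx. apply (integral_le f h hf hh T); auto; [apply Rabs_le_between |]; lra.
  - rewrite <- (opp_RInt_swap (V := R_CompleteNormedModule) _ t 0) by auto.
    rewrite <- (opp_RInt_swap (V := R_CompleteNormedModule) (integral h) t 0) by auto.
    apply Ropp_le_contravar. apply RInt_le; auto; [lra |].
    intros x hx. apply (integral_le f h hf hh T); auto; [apply Rabs_le_between |]; lra.
Qed.

Lemma double_integral_const (k t : R) : double_integral (fun _ => k) t = k * t ^ 2 / 2.
Proof.
  unfold double_integral.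
  rewrite (integral_ext _ (fun r => k * r)).
  2:{ intros r. rewrite (integral_unique (fun r => k * r) (fun _ => k)).
      - ring.
      - intros x. auto_derive; [exact I | ring].
      - intros x. apply continuous_const. }
  rewrite (integral_unique (fun r => k * r ^ 2 / 2) (fun r => k * r)).
  - field.
  - intros x. auto_derive; [exact I | field].
  - intros x. apply (ex_derive_continuous (V := R_NormedModule)). auto_derive. exact I.
Qed.

Lemma double_integral_cosh (k : R) (hk : k <> 0) (t : R) :
  double_integral (fun r => k ^ 2 * cosh (k * r)) t = cosh (k * t) - 1.
Proof.
  unfold double_integral, cosh.
  rewrite (integral_ext _ (fun r => k * sinh (k * r))).
  2:{ intros r.
      rewrite (integral_unique (fun r => k * sinh (k * r))
                 (fun r => k ^ 2 * ((exp (k * r) + exp (- (k * r))) / 2))).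
      - unfold sinh. rewrite Rmult_0_r, Ropp_0. field.
      - intros x. unfold sinh. auto_derive; [exact I | field].
      - intros x. apply (ex_derive_continuous (V := R_NormedModule)). auto_derive. exact I. }
  rewrite (integral_unique (fun r => (exp (k * r) + exp (- (k * r))) / 2)).
  - rewrite Rmult_0_r, Ropp_0, exp_0. field.
  - intros x. unfold sinh. auto_derive; [exact I | field].
  - intros x. unfold sinh. apply (ex_derive_continuous (V := R_NormedModule)).
    auto_derive. exact I.
Qed.

Lemma double_integral_pos (f : R -> R) (hf : forall x, continuous f x)
  (hpos : forall x, 0 < f x) (t : R) (ht : t <> 0) : 0 < double_integral f t.
Proof.
  assert (cinv : forall x, continuous (fun r => / f r) x).
  { intros x. apply continuous_comp; [apply hf |].
    apply continuous_Rinv. specialize (hpos x). lra. }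
  destruct (continuous_locally_bounded _ cinv (Rabs t)) as [M [hM hb]].
  assert (hinv := fun x => Rinv_0_lt_compat _ (hpos x)).
  assert (hM0 : 0 < M).
  { apply Rlt_le_trans with (/ f t); auto. apply hb. lra. }
  apply Rlt_le_trans with (double_integral (fun _ => / M) t).
  - rewrite double_integral_const.
    apply Rinv_0_lt_compat in hM0.
    assert (0 < t ^ 2) by (apply pow2_gt_0; auto).
    assert (0 < / M * t ^ 2) by now apply Rmult_lt_0_compat. lra.
  - apply double_integral_le with (T := Rabs t); auto; try lra.
    + intros x. apply continuous_const.
    + intros r hr. rewrite <- (Rinv_inv (f r)). apply Rinv_le_contravar; auto.
Qed.

(** * A sublinear Cauchy problem of second order *)

(** The last condition says that [phi x / x] is nonincreasing; it holds for
    nonnegative concave functions, in particular for powers of exponent at most 1,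
    and it is the only substitute for a Lipschitz condition used below. *)
Record sublinear (phi : R -> R) : Prop := {
  sublinear_continuous : forall x, continuous phi x;
  sublinear_nonneg : forall x, 0 <= phi x;
  sublinear_le : forall x y, x <= y -> phi x <= phi y;
  sublinear_homogeneous : forall k x, 1 <= k -> 0 <= x -> phi (k * x) <= k * phi x
}.

Lemma sublinear_affine_bound (phi : R -> R) (hphi : sublinear phi) (x : R) (hx : 0 <= x) :
  phi x <= phi 1 * (1 + x).
Proof.
  apply Rle_trans with (phi ((1 + x) * 1)).
  - apply (sublinear_le _ hphi). lra.
  - rewrite (Rmult_comm (phi 1)). apply (sublinear_homogeneous _ hphi); lra.
Qed.

(** Since [phi x / x] is nonincreasing, the graph of [phi] stays, on both sides
    of [y], between the horizontal line and the ray from the origin through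
    [(y, phi y)].  So [phi] is Lipschitz at a positive [y], with the slope of that
    ray as constant, for increments of any size. *)
Lemma sublinear_increment (phi : R -> R) (hphi : sublinear phi) (x y : R)
  (hx : 0 < x) (hy : 0 < y) :
  Rabs (phi x - phi y) <= phi y / y * Rabs (x - y).
Proof.
  assert (hc : forall a b, 0 < a -> a <= b -> phi b <= b / a * phi a).
  { intros a b ha hab. replace b with (b / a * a) at 1 by (field; lra).
    apply (sublinear_homogeneous _ hphi); [| lra].
    apply (Rmult_le_reg_r a); auto. field_simplify; lra. }
  destruct (Rle_lt_dec y x) as [h | h].
  - pose proof (sublinear_le _ hphi y x h).
    rewrite !Rabs_pos_eq by lra.
    pose proof (hc y x hy h).
    replace (phi y / y * (x - y)) with (x / y * phi y - phi y) by (field; lra). lra.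
  - pose proof (sublinear_le _ hphi x y (Rlt_le _ _ h)).
    rewrite !Rabs_left1 by lra.
    pose proof (hc x y hx (Rlt_le _ _ h)) as h1.
    assert (h2 : x / y * phi y <= x / y * (y / x * phi x)).
    { apply Rmult_le_compat_l; auto. apply Rlt_le, Rdiv_lt_0_compat; auto. }
    replace (x / y * (y / x * phi x)) with (phi x) in h2 by (field; lra).
    replace (phi y / y * - (x - y)) with (phi y - x / y * phi y) by (field; lra). lra.
Qed.

Definition forcing (g b phi f : R -> R) (t : R) : R := g t + b t * phi (f t).

Lemma forcingE g b phi f t : forcing g b phi f t = g t + b t * phi (f t).
Proof. reflexivity. Qed.

Fixpoint picard (g b phi : R -> R) (n : nat) : R -> R :=
  match n with
  | O => double_integral g
  | S n => double_integral (forcing g b phi (picard g b phi n))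
  end.

Lemma picard_S g b phi n :
  picard g b phi (S n) = double_integral (forcing g b phi (picard g b phi n)).
Proof. reflexivity. Qed.

Record cauchy_data (g b phi : R -> R) : Prop := {
  data_g : forall x, continuous g x;
  data_b : forall x, continuous b x;
  data_g_pos : forall x, 0 < g x;
  data_b_nonneg : forall x, 0 <= b x;
  data_phi : sublinear phi
}.

Lemma continuous_forcing g b phi (data : cauchy_data g b phi) (f : R -> R)
  (hf : forall x, continuous f x) (x : R) : continuous (forcing g b phi f) x.
Proof.
  apply (continuous_plus (V := R_NormedModule)); [apply data |].
  apply (continuous_mult (K := R_AbsRing)); [apply data |].
  apply continuous_comp; [apply hf |]. apply data.
Qed.

Lemma forcing_le g b phi (data : cauchy_data g b phi) (f h : R -> R) (t : R) :
  f t <= h t -> forcing g b phi f t <= forcing g b phi h t.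
Proof.
  intros le_fh. apply Rplus_le_compat_l, Rmult_le_compat_l; [apply data |].
  now apply (sublinear_le _ (data_phi _ _ _ data)).
Qed.

Lemma g_le_forcing g b phi (data : cauchy_data g b phi) (f : R -> R) (t : R) :
  g t <= forcing g b phi f t.
Proof.
  unfold forcing.
  assert (0 <= b t * phi (f t)); [| lra].
  apply Rmult_le_pos; [apply data | apply (data_phi _ _ _ data)].
Qed.

Lemma continuous_picard g b phi (data : cauchy_data g b phi) (n : nat) :
  forall x, continuous (picard g b phi n) x.
Proof.
  induction n as [| n IH]; intros x; apply continuous_double_integral; [apply data |].
  intros y. now apply continuous_forcing.
Qed.

Lemma continuous_forcing_picard g b phi (data : cauchy_data g b phi) (n : nat) :
  forall x, continuous (forcing g b phi (picard g b phi n)) x.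
Proof. apply continuous_forcing; [exact data | now apply continuous_picard]. Qed.

Lemma picard_0_le g b phi (data : cauchy_data g b phi) (n : nat) (t : R) :
  picard g b phi 0 t <= picard g b phi n t.
Proof.
  destruct n as [| n]; [lra |].
  apply double_integral_le with (T := Rabs t); try lra; [apply data | |].
  - apply (continuous_forcing_picard g b phi data).
  - intros r _. now apply g_le_forcing.
Qed.

Lemma picard_pos g b phi (data : cauchy_data g b phi) (n : nat) (t : R) :
  t <> 0 -> 0 < picard g b phi n t.
Proof.
  intros ht. apply Rlt_le_trans with (picard g b phi 0 t); [| now apply picard_0_le].
  apply double_integral_pos; auto; apply data.
Qed.

Lemma picard_at_0 g b phi (n : nat) : picard g b phi n 0 = 0.
Proof. destruct n; apply integral_0. Qed.

Lemma picard_nonneg g b phi (data : cauchy_data g b phi) (n : nat) (t : R) :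
  0 <= picard g b phi n t.
Proof.
  destruct (Req_dec t 0) as [-> | ht].
  - rewrite picard_at_0. lra.
  - now apply Rlt_le, picard_pos.
Qed.

Lemma picard_incr g b phi (data : cauchy_data g b phi) (n : nat) :
  forall t, picard g b phi n t <= picard g b phi (S n) t.
Proof.
  induction n as [| n IH]; intros t; [now apply picard_0_le |].
  apply double_integral_le with (T := Rabs t); try lra.
  - exact (continuous_forcing_picard g b phi data n).
  - exact (continuous_forcing_picard g b phi data (S n)).
  - intros r _. apply forcing_le; auto.
Qed.

(** Since the nonlinearity grows at most linearly, a fast enough hyperbolic
    cosine is a supersolution, and it bounds all iterates at once. *)
Lemma picard_le_cosh g b phi (data : cauchy_data g b phi) (T : R) :
  exists k, forall n t, Rabs t <= T -> picard g b phi n t <= cosh (k * t).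
Proof.
  destruct (continuous_locally_bounded g (data_g _ _ _ data) T) as [Mg [hMg hg]].
  destruct (continuous_locally_bounded b (data_b _ _ _ data) T) as [Mb [hMb hb]].
  pose proof (sublinear_nonneg _ (data_phi _ _ _ data) 1) as h1.
  set (k := 1 + Mg + 2 * Mb * phi 1).
  assert (h2 : 0 <= Mb * phi 1) by now apply Rmult_le_pos.
  assert (hk : 1 <= k) by (unfold k; lra).
  exists k.
  assert (hcosh : forall x, 1 <= cosh x).
  { intros x. unfold cosh. rewrite exp_Ropp. pose proof (exp_pos x) as he.
    assert (0 <= (exp x - 1) ^ 2 / exp x).
    { apply Rmult_le_pos; [apply pow2_ge_0 | apply Rlt_le, Rinv_0_lt_compat; auto]. }
    replace ((exp x + / exp x) / 2) with (1 + (exp x - 1) ^ 2 / exp x / 2) by (field; lra).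
    lra. }
  assert (hcont : forall x, continuous (fun r => k ^ 2 * cosh (k * r)) x).
  { intros x. unfold cosh. apply (ex_derive_continuous (V := R_NormedModule)).
    auto_derive. exact I. }
  assert (hsq : forall r, k * cosh (k * r) <= k ^ 2 * cosh (k * r)).
  { intros r. apply Rmult_le_compat_r; [pose proof (hcosh (k * r)); lra | nra]. }
  assert (hstep : forall f, (forall x, continuous f x) ->
            (forall r, Rabs r <= T -> f r <= k ^ 2 * cosh (k * r)) ->
            forall t, Rabs t <= T -> double_integral f t <= cosh (k * t)).
  { intros f cf hf t ht.
    apply Rle_trans with (double_integral (fun r => k ^ 2 * cosh (k * r)) t).
    - now apply double_integral_le with (T := T).
    - rewrite double_integral_cosh by lra. lra. }
  induction n as [| n IH]; [| rewrite picard_S]; apply hstep.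
  - apply data.
  - intros r hr. apply Rle_trans with (2 := hsq r).
    pose proof (hg r hr). pose proof (hcosh (k * r)).
    apply Rle_trans with (k * 1); [unfold k; lra | apply Rmult_le_compat_l; lra].
  - apply (continuous_forcing_picard g b phi data).
  - intros r hr. apply Rle_trans with (2 := hsq r).
    specialize (IH r hr). pose proof (hg r hr). pose proof (hb r hr).
    pose proof (hcosh (k * r)) as hc.
    pose proof (data_b_nonneg _ _ _ data r).
    pose proof (sublinear_affine_bound _ (data_phi _ _ _ data) _
                  (picard_nonneg _ _ _ data n r)) as ha.
    pose proof (sublinear_nonneg _ (data_phi _ _ _ data) (picard g b phi n r)).
    rewrite !forcingE. set (s := picard g b phi n r) in *. set (C := cosh (k * r)) in *.
    assert (phi s <= phi 1 * (2 * C)).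
    { apply Rle_trans with (1 := ha). apply Rmult_le_compat_l; lra. }
    assert (b r * phi s <= Mb * (phi 1 * (2 * C))) by (apply Rmult_le_compat; lra).
    assert (g r <= Mg * C).
    { apply Rle_trans with (Mg * 1); [lra | apply Rmult_le_compat_l; lra]. }
    replace (k * C) with (C + Mg * C + Mb * (phi 1 * (2 * C))) by (unfold k; ring).
    lra.
Qed.

(** On a bounded time interval the sublinear part of the forcing is at most [K]
    times the part [g].  Hence a relative gap of [d] between two iterates shrinks
    to [K / (1 + K) * d] at the next step: enlarging the argument by the factor
    [1 + d] enlarges only the sublinear part, and at most by that factor. *)
Lemma picard_geometric g b phi (data : cauchy_data g b phi) (T : R) :
  exists M K, 0 <= M /\ 0 <= K /\ forall n m t, Rabs t <= T ->
    picard g b phi n t <= M /\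
    picard g b phi (n + m) t <= (1 + K * (K / (1 + K)) ^ n) * picard g b phi n t.
Proof.
  destruct (picard_le_cosh g b phi data T) as [k hk].
  destruct (continuous_locally_bounded (fun r => cosh (k * r))) with (T := T)
    as [M [hM hMb]].
  { intros x. unfold cosh. apply (ex_derive_continuous (V := R_NormedModule)).
    auto_derive. exact I. }
  destruct (continuous_locally_bounded (fun r => b r * / g r)) with (T := T)
    as [N [hN hNb]].
  { intros x. apply (continuous_mult (K := R_AbsRing)); [apply data |].
    apply continuous_comp; [apply data |].
    apply continuous_Rinv. pose proof (data_g_pos _ _ _ data x). lra. }
  assert (hbd : forall n t, Rabs t <= T -> picard g b phi n t <= M).
  { intros n t ht. apply Rle_trans with (cosh (k * t)); auto. }
  pose proof (sublinear_nonneg _ (data_phi _ _ _ data) M) as hphiM.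
  set (K := N * phi M).
  assert (hK : 0 <= K) by now apply Rmult_le_pos.
  set (q := K / (1 + K)).
  assert (hq : 0 <= q).
  { apply Rmult_le_pos; [lra | apply Rlt_le, Rinv_0_lt_compat; lra]. }
  assert (hfrac : forall n t, Rabs t <= T ->
            0 <= b t * phi (picard g b phi n t) <= K * g t).
  { intros n t ht. pose proof (data_g_pos _ _ _ data t).
    pose proof (data_b_nonneg _ _ _ data t).
    pose proof (sublinear_nonneg _ (data_phi _ _ _ data) (picard g b phi n t)) as h1.
    pose proof (sublinear_le _ (data_phi _ _ _ data) _ _ (hbd n t ht)) as h2.
    split; [now apply Rmult_le_pos |].
    assert (b t <= N * g t).
    { replace (b t) with (b t * / g t * g t) by (field; lra).
      apply Rmult_le_compat_r; auto; lra. }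
    apply Rle_trans with (N * g t * phi M); [| unfold K; lra].
    apply Rmult_le_compat; auto. }
  exists M, K. split; [exact hM |]. split; [exact hK |].
  intros n m t ht. split; [now apply hbd |].
  fold q. revert t ht. induction n as [| n IH]; intros t ht.
  - simpl pow. rewrite Rmult_1_r. rewrite ?Nat.add_0_l, ?Nat.add_succ_l.
    destruct m as [| m].
    + pose proof (picard_nonneg _ _ _ data 0 t) as h0.
      apply (Rmult_le_compat_l K) in h0; lra.
    + rewrite picard_S. change (picard g b phi 0) with (double_integral g).
      rewrite <- double_integral_scal by apply data.
      apply double_integral_le with (T := T); auto.
      * apply (continuous_forcing_picard g b phi data).
      * intros x. apply (continuous_scal_r (K := R_AbsRing) (V := R_NormedModule)).
        apply data.
      * intros r hr. destruct (hfrac m r hr). rewrite !forcingE. lra.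
  - rewrite ?Nat.add_0_l, ?Nat.add_succ_l. rewrite !picard_S.
    rewrite <- double_integral_scal by (apply (continuous_forcing_picard g b phi data)).
    apply double_integral_le with (T := T); auto.
    + apply (continuous_forcing_picard g b phi data).
    + intros x. apply (continuous_scal_r (K := R_AbsRing) (V := R_NormedModule)).
      apply (continuous_forcing_picard g b phi data).
    + intros r hr. specialize (IH r hr).
      set (d := K * q ^ n) in IH.
      assert (hd : 0 <= d) by (apply Rmult_le_pos; [lra | now apply pow_le]).
      replace (K * q ^ S n) with (q * d) by (unfold d; simpl; ring).
      destruct (hfrac n r hr) as [hf0 hf].
      rewrite !forcingE. set (s := picard g b phi n r) in *.
      assert (phi (picard g b phi (n + m) r) <= (1 + d) * phi s).
      { apply Rle_trans with (phi ((1 + d) * s)).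
        - now apply (sublinear_le _ (data_phi _ _ _ data)).
        - apply (sublinear_homogeneous _ (data_phi _ _ _ data)); [lra |].
          now apply picard_nonneg. }
      assert (b r * phi (picard g b phi (n + m) r) <= (1 + d) * (b r * phi s)).
      { replace ((1 + d) * (b r * phi s)) with (b r * ((1 + d) * phi s)) by ring.
        apply Rmult_le_compat_l; auto. apply data. }
      set (h := b r * phi s) in *.
      assert (hqh : h <= q * (g r + h)).
      { apply (Rmult_le_reg_l (1 + K)); [lra |]. unfold q.
        replace ((1 + K) * (K / (1 + K) * (g r + h))) with (K * (g r + h)) by (field; lra).
        lra. }
      assert (d * h <= d * (q * (g r + h))) by now apply Rmult_le_compat_l.
      lra.
Qed.

(** The Cauchy problem [S'' = g + b phi(S)], [S(0) = S'(0) = 0], is solvable on the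
    whole line although [phi] need not be Lipschitz at the initial value 0: the
    Picard iterates increase and converge geometrically in the relative sense of
    [picard_geometric], and the limit [S] is squeezed between its own image and
    the iterates, so that it is a fixed point. *)
Lemma sublinear_cauchy g b phi (data : cauchy_data g b phi) :
  exists S Y : R -> R, S 0 = 0 /\ Y 0 = 0 /\
    (forall t, is_derive S t (Y t)) /\
    (forall t, is_derive Y t (g t + b t * phi (S t))) /\
    (forall t, t <> 0 -> 0 < S t).
Proof.
  set (P := picard g b phi).
  assert (hlim : forall t, exists l, is_lim_seq (fun n => P n t) (Finite l)).
  { intros t. destruct (picard_geometric g b phi data (Rabs t)) as [M [K [_ [_ h]]]].
    apply (ex_finite_lim_seq_incr _ M).
    - intros n. now apply picard_incr.
    - intros n. apply (h n O t). lra. }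
  set (sol := fun t => real (Lim_seq (fun n => P n t))).
  assert (hS : forall t, is_lim_seq (fun n => P n t) (sol t)).
  { intros t. destruct (hlim t) as [l hl]. unfold sol.
    now rewrite (is_lim_seq_unique _ _ hl). }
  assert (hlow : forall n t, P n t <= sol t).
  { intros n t. apply (is_lim_seq_incr_compare (fun n => P n t)); auto.
    intros k. now apply picard_incr. }
  assert (hup : forall T, exists M K q, 0 <= M /\ 0 <= K /\ 0 <= q < 1 /\
            forall n t, Rabs t <= T ->
              P n t <= M /\ sol t <= (1 + K * q ^ n) * P n t).
  { intros T. destruct (picard_geometric g b phi data T) as [M [K [hM [hK h]]]].
    exists M, K, (K / (1 + K)). split; [auto |]. split; [auto |]. split.
    - split; [apply Rmult_le_pos; [lra | apply Rlt_le, Rinv_0_lt_compat; lra] |].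
      apply (Rmult_lt_reg_r (1 + K)); [lra |]. field_simplify; lra.
    - intros n t ht. split; [apply (h n O t ht) |].
      assert (hl : is_lim_seq (fun m => P (m + n)%nat t) (sol t)).
      { apply (is_lim_seq_incr_n (fun m => P m t) n). apply hS. }
      apply (is_lim_seq_le (fun m => P (m + n)%nat t)
               (fun _ => (1 + K * (K / (1 + K)) ^ n) * P n t)
               (sol t) ((1 + K * (K / (1 + K)) ^ n) * P n t)); auto.
      + intros m. rewrite Nat.add_comm. apply (h n m t ht).
      + apply is_lim_seq_const. }
  assert (hgeo : forall K q e, 0 <= q < 1 -> 0 < e -> exists n, K * q ^ n < e).
  { intros K q e hq he.
    assert (hz : is_lim_seq (fun n => K * q ^ n) 0).
    { replace (Finite 0) with (Rbar_mult K 0) by (simpl; f_equal; ring).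
      apply is_lim_seq_scal_l. apply is_lim_seq_geom. rewrite Rabs_pos_eq; lra. }
    apply is_lim_seq_spec in hz. destruct (hz (mkposreal e he)) as [n hn].
    exists n. specialize (hn n (Nat.le_refl _)). simpl in hn.
    apply Rabs_lt_between in hn. lra. }
  assert (cS : forall t, continuous sol t).
  { intros t. destruct (hup (Rabs t + 1)) as [M [K [q [hM [hK [hq h]]]]]].
    apply (filterlim_locally (F := locally t)). intros e.
    assert (he : 0 < e / 3) by (pose proof (cond_pos e); lra).
    destruct (hgeo (K * M) q (e / 3) hq he) as [n hn].
    assert (hclose : forall r, Rabs r <= Rabs t + 1 -> 0 <= sol r - P n r < e / 3).
    { intros r hr. specialize (hlow n r). destruct (h n r hr) as [h1 h2].
      assert (K * q ^ n * P n r <= K * q ^ n * M).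
      { apply Rmult_le_compat_l; auto. apply Rmult_le_pos; auto. now apply pow_le. }
      lra. }
    pose proof (continuous_picard g b phi data n t) as hc.
    apply (filterlim_locally (F := locally t)) with (eps := mkposreal _ he) in hc.
    destruct hc as [d hd].
    assert (hm : 0 < Rmin d 1) by (apply Rmin_pos; [apply cond_pos | lra]).
    exists (mkposreal _ hm). intros r hr.
    assert (hr1 : Rabs (r - t) < Rmin d 1) by exact hr.
    assert (hr2 : Rabs (P n r - P n t) < e / 3).
    { apply hd. change (Rabs (r - t) < d).
      apply Rlt_le_trans with (1 := hr1). apply Rmin_l. }
    assert (hr3 : Rabs r <= Rabs t + 1).
    { replace r with (t + (r - t)) by ring.
      apply Rle_trans with (1 := Rabs_triang _ _).
      pose proof (Rmin_r d 1). lra. }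
    pose proof (hclose r hr3). pose proof (hclose t ltac:(lra)).
    change (Rabs (sol r - sol t) < e).
    apply Rabs_lt_between in hr2. apply Rabs_lt_between. lra. }
  assert (cF : forall x, continuous (forcing g b phi sol) x)
    by now apply continuous_forcing.
  assert (hfix : forall t, double_integral (forcing g b phi sol) t = sol t).
  { intros t.
    assert (hge : forall n, P (S n) t <= double_integral (forcing g b phi sol) t).
    { intros n. apply double_integral_le with (T := Rabs t); auto; try lra.
      - apply (continuous_forcing_picard g b phi data).
      - intros r _. apply forcing_le; auto. }
    destruct (hup (Rabs t)) as [M [K [q [hM [hK [hq h]]]]]].
    apply Rle_antisym.
    - apply le_epsilon. intros e he.
      destruct (hgeo (K * M) q e hq he) as [n hn].
      assert (hd : 0 <= K * q ^ n) by (apply Rmult_le_pos; [auto | apply pow_le; lra]).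
      assert (hle : double_integral (forcing g b phi sol) t
                    <= (1 + K * q ^ n) * P (S n) t).
      { change (P (S n) t) with (double_integral (forcing g b phi (P n)) t).
        assert (cFn : forall x, continuous (forcing g b phi (P n)) x)
          by (apply (continuous_forcing_picard g b phi data)).
        rewrite <- double_integral_scal by auto.
        apply double_integral_le with (T := Rabs t); auto; try lra.
        - intros x. now apply (continuous_scal_r (K := R_AbsRing) (V := R_NormedModule)).
        - intros r hr. rewrite !forcingE.
          assert (h1 : phi (sol r) <= (1 + K * q ^ n) * phi (P n r)).
          { apply Rle_trans with (phi ((1 + K * q ^ n) * P n r)).
            - apply (sublinear_le _ (data_phi _ _ _ data)). now apply h.
            - apply (sublinear_homogeneous _ (data_phi _ _ _ data)); [lra |].
              now apply picard_nonneg. }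
          apply (Rmult_le_compat_l (b r)) in h1; [| apply data].
          assert (0 <= K * q ^ n * g r)
            by (apply Rmult_le_pos; [lra | apply Rlt_le, data]).
          lra. }
      assert (hP : P (S n) t <= M) by (apply h; lra).
      pose proof (hlow (S n) t).
      apply (Rmult_le_compat_l (K * q ^ n)) in hP; auto. lra.
    - apply (is_lim_seq_le (fun n => P (S n) t)
               (fun _ => double_integral (forcing g b phi sol) t)
               (sol t) (double_integral (forcing g b phi sol) t)); auto.
      + apply (is_lim_seq_incr_1 (fun n => P n t)). apply hS.
      + apply is_lim_seq_const. }
  exists sol, (integral (forcing g b phi sol)).
  split; [rewrite <- hfix; apply integral_0 |].
  split; [apply integral_0 |].
  split; [| split].
  - intros t. apply (is_derive_ext (double_integral (forcing g b phi sol))); auto.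
    apply is_derive_integral. now apply continuous_integral.
  - exact (is_derive_integral _ cF).
  - intros t ht. apply Rlt_le_trans with (P O t); auto. now apply picard_pos.
Qed.

(** * Convergence in the distant past *)

Lemma nonneg_derivative_le (f df : R -> R) (a b : R) (hab : a <= b)
  (hf : forall x, a <= x <= b -> is_derive f x (df x))
  (hdf : forall x, a <= x <= b -> 0 <= df x) : f a <= f b.
Proof.
  destruct (MVT_gen f a b df) as [x [hx e]].
  - intros x hx. apply hf. rewrite Rmin_left, Rmax_right in hx by lra. lra.
  - intros x hx. apply derivable_continuous_pt. exists (df x).
    apply is_derive_Reals. apply hf. rewrite Rmin_left, Rmax_right in hx by lra. lra.
  - rewrite Rmin_left, Rmax_right in hx by lra.
    pose proof (hdf x hx).
    assert (0 <= df x * (b - a)) by (apply Rmult_le_pos; lra). lra.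
Qed.

(** A function that grows at least exponentially, up to a small error, has to be
    small far in the past. *)
Lemma limit_of_exponential_growth (V dV : R -> R) (k : R) (hk : 0 < k)
  (hV0 : forall z, 0 <= V z)
  (hV : forall z, z < 0 -> is_derive V z (dV z))
  (hgrow : forall eps, 0 < eps ->
     exists Z, Z < 0 /\ forall z, z <= Z -> k * V z - eps <= dV z) :
  is_lim V m_infty 0.
Proof.
  apply is_lim_spec. intros e. pose proof (cond_pos e) as he.
  destruct (hgrow (k * (e / 2))) as [Z [hZ hg]].
  { apply Rmult_lt_0_compat; lra. }
  assert (hmul : forall z, z <= Z ->
            exp (k * (Z - z)) * (V z - e / 2) <= V Z - e / 2).
  { intros z hz.
    replace (V Z - e / 2) with (exp (k * (Z - Z)) * (V Z - e / 2)).
    2:{ rewrite Rminus_diag, Rmult_0_r, exp_0. ring. }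
    apply (nonneg_derivative_le (fun x => exp (k * (Z - x)) * (V x - e / 2))
             (fun x => exp (k * (Z - x)) * (dV x - k * (V x - e / 2)))); auto.
    - intros x hx.
      assert (hd : is_derive V x (dV x)) by (apply hV; lra).
      auto_derive.
      + exists (dV x). exact hd.
      + replace (Derive (fun x0 : R => V x0) x) with (dV x)
          by (symmetry; now apply is_derive_unique).
        unfold Rminus. ring.
    - intros x hx. apply Rmult_le_pos; [apply Rlt_le, exp_pos |].
      pose proof (hg x ltac:(lra)). lra. }
  exists (Z - 2 * (V Z + 1) / (k * e)). intros z hz.
  pose proof (hV0 z) as h0. pose proof (hV0 Z) as h1.
  assert (hke : 0 < k * e) by now apply Rmult_lt_0_compat.
  assert (hz1 : 2 * (V Z + 1) / (k * e) < Z - z) by lra.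
  assert (hpos : 0 < 2 * (V Z + 1) / (k * e)) by (apply Rdiv_lt_0_compat; lra).
  rewrite Rminus_0_r, Rabs_pos_eq by auto.
  destruct (Rlt_le_dec (V z) e) as [h | h]; auto. exfalso.
  pose proof (hmul z ltac:(lra)) as h2.
  assert (h3 : 1 + k * (Z - z) <= exp (k * (Z - z))).
  { apply Rlt_le, exp_ineq1. intros h3.
    assert (0 < k * (Z - z)) by (apply Rmult_lt_0_compat; lra). lra. }
  assert (h4 : 2 * (V Z + 1) / e < k * (Z - z)).
  { apply (Rmult_lt_compat_l k) in hz1; auto.
    replace (k * (2 * (V Z + 1) / (k * e))) with (2 * (V Z + 1) / e) in hz1
      by (field; lra). lra. }
  assert (h5 : 2 * (V Z + 1) / e * (e / 2) <= exp (k * (Z - z)) * (V z - e / 2)).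
  { apply Rmult_le_compat; try lra. apply Rmult_le_pos; [lra |].
    apply Rlt_le, Rinv_0_lt_compat; auto. }
  replace (2 * (V Z + 1) / e * (e / 2)) with (V Z + 1) in h5 by (field; lra). lra.
Qed.

(** [d^2 + e^2] is a Lyapunov function in backward time: the linear part
    [w (d - e)], [w (e - q d)] has the quadratic form [d^2 - (1 + q) d e + e^2],
    in the worst case, positive definite for [q < 1]. *)
Lemma backward_convergence (w q : R) (hw : 0 < w) (hq : 0 <= q < 1) (d e r : R -> R)
  (hd : forall z, z < 0 -> is_derive d z (w * (d z - e z)))
  (he : forall z, z < 0 -> is_derive e z (w * (e z - r z)))
  (hr : forall eps, 0 < eps ->
     exists Z, Z < 0 /\ forall z, z <= Z -> Rabs (r z) <= q * Rabs (d z) + eps) :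
  is_lim d m_infty 0 /\ is_lim e m_infty 0.
Proof.
  set (V := fun z => d z ^ 2 + e z ^ 2).
  assert (hV : is_lim V m_infty 0).
  { apply (limit_of_exponential_growth V
      (fun z => 2 * w * (d z * (d z - e z) + e z * (e z - r z))) (w * (1 - q) / 2)).
    - apply Rdiv_lt_0_compat; [apply Rmult_lt_0_compat |]; lra.
    - intros z. unfold V. pose proof (pow2_ge_0 (d z)). pose proof (pow2_ge_0 (e z)). lra.
    - intros z hz. unfold V.
      pose proof (hd z hz) as h1. pose proof (he z hz) as h2.
      auto_derive.
      + split; [eexists; exact h1 |]. split; [eexists; exact h2 | exact I].
      + replace (Derive (fun x : R => d x) z) with (w * (d z - e z))
          by (symmetry; now apply is_derive_unique).
        replace (Derive (fun x : R => e x) z) with (w * (e z - r z))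
          by (symmetry; now apply is_derive_unique).
        ring.
    - intros eps heps.
      (* The quadratic form is at least [(1 - q) / 2 * V]; Young's inequality spends
         half of this on the error term. *)
      set (x := sqrt (eps * (1 - q) / (2 * w))).
      assert (hx0 : 0 < eps * (1 - q) / (2 * w)).
      { apply Rdiv_lt_0_compat; [apply Rmult_lt_0_compat |]; lra. }
      assert (hx : 0 < x) by now apply sqrt_lt_R0.
      assert (hx2 : x * x = eps * (1 - q) / (2 * w)) by (apply sqrt_sqrt; lra).
      destruct (hr x hx) as [Z [hZ h]]. exists Z. split; auto.
      intros z hz. specialize (h z hz). unfold V.
      set (D := d z) in *. set (E := e z) in *. set (r0 := r z) in *.
      set (a := Rabs D) in *. set (b := Rabs E).
      assert (ha : D ^ 2 = a ^ 2) by (symmetry; apply pow2_abs).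
      assert (hb : E ^ 2 = b ^ 2) by (symmetry; apply pow2_abs).
      assert (ha0 : 0 <= a) by apply Rabs_pos.
      assert (hb0 : 0 <= b) by apply Rabs_pos.
      assert (h1 : D * E <= a * b) by (unfold a, b; rewrite <- Rabs_mult; apply Rle_abs).
      assert (h2 : E * r0 <= b * (q * a + x)).
      { apply Rle_trans with (1 := Rle_abs _). rewrite Rabs_mult.
        apply Rmult_le_compat_l; auto. }
      assert (h3 : (1 - q) / 4 * (D ^ 2 + E ^ 2) - x * x / (1 - q)
                   <= D * (D - E) + E * (E - r0)).
      { replace (D * (D - E) + E * (E - r0)) with (D ^ 2 - D * E + E ^ 2 - E * r0) by ring.
        rewrite ha, hb.
        assert (h4 : 0 <= (1 + q) / 2 * (a - b) ^ 2).
        { apply Rmult_le_pos; [lra | apply pow2_ge_0]. }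
        assert (h5 : 0 <= ((1 - q) / 2 * b - x) ^ 2 / (1 - q)).
        { apply Rmult_le_pos; [apply pow2_ge_0 | apply Rlt_le, Rinv_0_lt_compat; lra]. }
        replace (((1 - q) / 2 * b - x) ^ 2 / (1 - q))
          with ((1 - q) / 4 * b ^ 2 - b * x + x * x / (1 - q)) in h5 by (field; lra).
        assert (h6 : 0 <= (1 - q) / 4 * a ^ 2).
        { apply Rmult_le_pos; [lra | apply pow2_ge_0]. }
        lra. }
      apply (Rmult_le_compat_l (2 * w)) in h3; [| lra].
      rewrite hx2 in h3.
      replace (2 * w * ((1 - q) / 4 * (D ^ 2 + E ^ 2)
                        - eps * (1 - q) / (2 * w) / (1 - q)))
        with (w * (1 - q) / 2 * (D ^ 2 + E ^ 2) - eps) in h3 by (field; lra).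
      exact h3. }
  assert (hsq : forall f : R -> R, (forall z, f z ^ 2 <= V z) -> is_lim f m_infty 0).
  { intros f hf. apply is_lim_spec. intros eps. pose proof (cond_pos eps) as hp.
    apply is_lim_spec in hV.
    destruct (hV (mkposreal (eps * eps) (Rmult_lt_0_compat _ _ hp hp))) as [Z h].
    exists Z. intros z hz. specialize (h z hz). simpl in h. specialize (hf z).
    rewrite Rminus_0_r in *.
    rewrite <- (Rabs_pos_eq eps) by lra. apply Rsqr_lt_abs_0.
    unfold Rsqr. apply Rabs_lt_between in h. simpl in hf. lra. }
  split; apply hsq; intros z; unfold V.
  - pose proof (pow2_ge_0 (e z)). lra.
  - pose proof (pow2_ge_0 (d z)). lra.
Qed.

(** The left state is an equilibrium of the limiting system.  There the secant
    slope of the nonlinearity is [aL * phi sL / sL = w ^ 2 - B / sL], below [w ^ 2]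
    since [B > 0]; this is the contraction that [backward_convergence] asks for.
    The distance of [a] to its limit is absorbed in half of the gap between the two
    slopes. *)
Lemma profile_limit (phi : R -> R) (hphi : sublinear phi) (w B aL sL : R) (hw : 0 < w)
  (hB : 0 < B) (haL : 0 <= aL) (hsL : 0 < sL) (heq : w ^ 2 * sL = B + aL * phi sL)
  (a s y : R -> R) (ha : is_lim a m_infty aL)
  (hs : forall z, z < 0 -> is_derive s z (w * s z - y z))
  (hy : forall z, z < 0 -> is_derive y z (w * y z - B - a z * phi (s z)))
  (hpos : forall z, z < 0 -> 0 < s z) :
  is_lim s m_infty sL /\ is_lim y m_infty (w * sL).
Proof.
  assert (hw2 : 0 < w ^ 2) by now apply pow_lt.
  assert (hwi : 0 < / w ^ 2) by now apply Rinv_0_lt_compat.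
  pose proof (sublinear_nonneg _ hphi sL) as hp.
  set (q := aL * (phi sL / sL) / w ^ 2).
  assert (hc0 : 0 <= phi sL / sL).
  { apply Rmult_le_pos; auto. now apply Rlt_le, Rinv_0_lt_compat. }
  assert (hq0 : 0 <= q).
  { apply Rmult_le_pos; [now apply Rmult_le_pos | lra]. }
  assert (hq1 : q < 1).
  { apply (Rmult_lt_reg_r (w ^ 2 * sL)); [now apply Rmult_lt_0_compat |].
    replace (q * (w ^ 2 * sL)) with (aL * phi sL) by (unfold q; field; lra). lra. }
  destruct (backward_convergence w ((1 + q) / 2) hw ltac:(lra)
    (fun z => s z - sL) (fun z => y z / w - sL)
    (fun z => (a z * phi (s z) - aL * phi sL) / w ^ 2)) as [hd he].
  - intros z hz. pose proof (hs z hz) as h. auto_derive.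
    + eexists; exact h.
    + replace (Derive (fun x : R => s x) z) with (w * s z - y z)
        by (symmetry; now apply is_derive_unique). field. lra.
  - intros z hz. pose proof (hy z hz) as h. auto_derive.
    + eexists; exact h.
    + replace (Derive (fun x : R => y x) z) with (w * y z - B - a z * phi (s z))
        by (symmetry; now apply is_derive_unique).
      replace B with (w ^ 2 * sL - aL * phi sL) by lra. field. lra.
  - intros eps heps.
    set (N := phi sL / w ^ 2 * (/ eps + 2 / (sL * (1 - q))) + 1).
    assert (hN1 : 0 < / eps) by now apply Rinv_0_lt_compat.
    assert (hN2 : 0 < 2 / (sL * (1 - q))).
    { apply Rdiv_lt_0_compat; [lra | apply Rmult_lt_0_compat; lra]. }
    assert (hpw : 0 <= phi sL / w ^ 2) by (apply Rmult_le_pos; lra).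
    assert (hm1 : 0 <= phi sL / w ^ 2 * / eps) by (apply Rmult_le_pos; lra).
    assert (hm2 : 0 <= phi sL / w ^ 2 * (2 / (sL * (1 - q))))
      by (apply Rmult_le_pos; lra).
    assert (hN : 0 < N) by (unfold N; lra).
    assert (heta : 0 < / N) by now apply Rinv_0_lt_compat.
    apply is_lim_spec in ha. destruct (ha (mkposreal _ heta)) as [Z hZ].
    exists (Rmin (Z - 1) (-1)). split.
    { apply Rle_lt_trans with (-1); [apply Rmin_r | lra]. }
    intros z hz.
    pose proof (Rmin_l (Z - 1) (-1)). pose proof (Rmin_r (Z - 1) (-1)).
    specialize (hZ z ltac:(lra)). simpl in hZ.
    pose proof (hpos z ltac:(lra)) as hsz.
    pose proof (sublinear_increment _ hphi (s z) sL hsz hsL) as hi.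
    set (D := Rabs (s z - sL)) in *.
    assert (hD : 0 <= D) by apply Rabs_pos.
    assert (hphis : phi (s z) <= phi sL + phi sL / sL * D).
    { apply Rle_trans with (phi sL + Rabs (phi (s z) - phi sL)); [| lra].
      pose proof (Rle_abs (phi (s z) - phi sL)). lra. }
    unfold Rdiv at 1. rewrite Rabs_mult, (Rabs_pos_eq (/ w ^ 2)) by lra.
    assert (h1 : Rabs (a z * phi (s z) - aL * phi sL)
                 <= / N * (phi sL + phi sL / sL * D) + aL * (phi sL / sL * D)).
    { replace (a z * phi (s z) - aL * phi sL)
        with ((a z - aL) * phi (s z) + aL * (phi (s z) - phi sL)) by ring.
      apply Rle_trans with (1 := Rabs_triang _ _). rewrite !Rabs_mult.
      apply Rplus_le_compat.
      - apply Rmult_le_compat; auto using Rabs_pos; [lra |].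
        rewrite Rabs_pos_eq; auto. apply hphi.
      - rewrite (Rabs_pos_eq aL) by auto. apply Rmult_le_compat_l; auto. }
    apply (Rmult_le_compat_r (/ w ^ 2)) in h1; [| lra].
    apply Rle_trans with (1 := h1).
    (* [N] exceeds both quotients, so [/ N] pays for [eps] and for half the gap [1 - q]. *)
    assert (h2 : / N * (phi sL / w ^ 2) <= eps).
    { apply (Rmult_le_reg_l N); auto. rewrite <- Rmult_assoc, Rinv_r, Rmult_1_l by lra.
      apply Rle_trans with (phi sL / w ^ 2 * / eps * eps).
      - rewrite Rmult_assoc, Rinv_l by lra. lra.
      - apply Rmult_le_compat_r; unfold N; lra. }
    assert (h3 : / N * (phi sL / w ^ 2) / sL <= (1 - q) / 2).
    { apply (Rmult_le_reg_l N); auto.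
      replace (N * (/ N * (phi sL / w ^ 2) / sL)) with (phi sL / w ^ 2 / sL)
        by (field; lra).
      apply Rle_trans with (phi sL / w ^ 2 * (2 / (sL * (1 - q))) * ((1 - q) / 2)).
      - apply Req_le. field. lra.
      - apply Rmult_le_compat_r; unfold N; lra. }
    apply (Rmult_le_compat_r D) in h3; auto.
    replace ((/ N * (phi sL + phi sL / sL * D) + aL * (phi sL / sL * D)) * / w ^ 2)
      with (/ N * (phi sL / w ^ 2) + / N * (phi sL / w ^ 2) / sL * D + q * D)
      by (unfold q; field; lra).
    lra.
  - split.
    + apply (is_lim_ext (fun z => (s z - sL) + sL)); [intros z; ring |].
      replace (Finite sL) with (Finite (0 + sL)) by (f_equal; ring).
      apply (is_lim_plus' _ _ _ _ _ hd). apply is_lim_const.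
    + apply (is_lim_ext (fun z => w * ((y z / w - sL) + sL))); [intros z; field; lra |].
      replace (Finite (w * sL)) with (Rbar_mult w (Finite (0 + sL)))
        by (simpl; f_equal; ring).
      apply is_lim_scal_l. apply (is_lim_plus' _ _ _ _ _ he). apply is_lim_const.
Qed.

(** * The profile for a power law *)

(** The continuous extension of the power by 0; [Rpower] itself takes the value 1
    at 0. *)
Definition positive_power (alpha x : R) : R :=
  if Rle_dec x 0 then 0 else Rpower x alpha.

Lemma positive_power_pos (alpha x : R) : 0 < x -> positive_power alpha x = Rpower x alpha.
Proof. intros hx. unfold positive_power. destruct (Rle_dec x 0); [lra | reflexivity]. Qed.

Lemma positive_power_nonpos (alpha x : R) : x <= 0 -> positive_power alpha x = 0.
Proof. intros hx. unfold positive_power. destruct (Rle_dec x 0); [reflexivity | lra]. Qed.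

Lemma positive_power_exp_mult (alpha k x : R) :
  positive_power alpha (exp k * x) = exp (alpha * k) * positive_power alpha x.
Proof.
  pose proof (exp_pos k) as hk.
  destruct (Rle_lt_dec x 0) as [hx | hx].
  - rewrite !positive_power_nonpos; auto; [ring |].
    apply (Rmult_le_compat_l (exp k)) in hx; lra.
  - rewrite !positive_power_pos; auto; [| now apply Rmult_lt_0_compat].
    rewrite <- Rpower_mult_distr by auto.
    unfold Rpower at 1. now rewrite ln_exp.
Qed.

Lemma continuous_positive_power (alpha : R) (ha : 0 < alpha) (x : R) :
  continuous (positive_power alpha) x.
Proof.
  destruct (Rtotal_order x 0) as [hx | [-> | hx]].
  - apply (continuous_ext_loc _ (fun _ => 0)); [| apply continuous_const].
    apply (filter_imp (fun y => y < 0)); [| now apply open_lt].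
    intros y hy. symmetry. apply positive_power_nonpos. lra.
  - apply (filterlim_locally (F := locally 0)). intros e. pose proof (cond_pos e) as he.
    exists (mkposreal _ (exp_pos (/ alpha * ln e))). intros y hy.
    assert (hy1 : Rabs (y - 0) < exp (/ alpha * ln e)) by exact hy.
    change (Rabs (positive_power alpha y - positive_power alpha 0) < e).
    rewrite (positive_power_nonpos alpha 0), Rminus_0_r in * by lra.
    destruct (Rle_lt_dec y 0) as [h | h].
    + rewrite positive_power_nonpos, Rabs_R0; auto.
    + rewrite positive_power_pos by auto.
      rewrite Rabs_pos_eq in hy1 by lra.
      rewrite Rabs_pos_eq by (apply Rlt_le, exp_pos).
      rewrite <- (exp_ln e) by auto. unfold Rpower. apply exp_increasing.
      apply ln_increasing in hy1; auto. rewrite ln_exp in hy1.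
      apply (Rmult_lt_compat_l alpha) in hy1; auto.
      rewrite <- Rmult_assoc, Rinv_r, Rmult_1_l in hy1 by lra. exact hy1.
  - apply (continuous_ext_loc _ (fun y => exp (alpha * ln y))).
    + apply (filter_imp (fun y => 0 < y)); [| now apply open_gt].
      intros y hy. symmetry. now apply positive_power_pos.
    + apply (ex_derive_continuous (V := R_NormedModule)). auto_derive. exact hx.
Qed.

(** The exponent at most 1 enters here: [(k x)^alpha = k^alpha x^alpha] and
    [k^alpha <= k] for [1 <= k]. *)
Lemma sublinear_positive_power (alpha : R) (ha : 0 < alpha <= 1) :
  sublinear (positive_power alpha).
Proof.
  assert (hnn : forall x, 0 <= positive_power alpha x).
  { intros x. unfold positive_power. destruct (Rle_dec x 0); [lra |].
    apply Rlt_le, exp_pos. }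
  split; auto.
  - apply continuous_positive_power. lra.
  - intros x y hxy. destruct (Rle_lt_dec x 0) as [hx | hx].
    + now rewrite (positive_power_nonpos alpha x).
    + rewrite !positive_power_pos by lra. apply Rle_Rpower_l; lra.
  - intros k x hk hx. rewrite <- (exp_ln k) at 1 by lra.
    rewrite positive_power_exp_mult. apply Rmult_le_compat_r; auto.
    rewrite <- (exp_ln k) at 2 by lra.
    assert (hl : 0 <= ln k).
    { rewrite <- ln_1. destruct hk as [hk | <-]; [| lra].
      apply Rlt_le, ln_increasing; lra. }
    assert (hle : alpha * ln k <= ln k).
    { rewrite <- (Rmult_1_l (ln k)) at 2. apply Rmult_le_compat_r; lra. }
    destruct hle as [h | ->]; [| lra]. now apply Rlt_le, exp_increasing.
Qed.

(** Multiplying by the integrating factor [exp (- w z)] turns the first-order system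
    for the specific volume [s] and the relative velocity [y] into the Cauchy
    problem of [sublinear_cauchy]; a power law keeps its form under this scaling. *)
Lemma profile_exists (alpha w B : R) (ha : 0 < alpha <= 1) (hB : 0 < B) (a : R -> R)
  (ca : forall z, continuous a z) (ha0 : forall z, 0 <= a z) :
  exists s y : R -> R, s 0 = 0 /\ y 0 = 0 /\
    (forall z, is_derive s z (w * s z - y z)) /\
    (forall z, is_derive y z (w * y z - B - a z * positive_power alpha (s z))) /\
    (forall z, z <> 0 -> 0 < s z).
Proof.
  destruct (sublinear_cauchy (fun z => B * exp (- w * z))
              (fun z => a z * exp ((alpha - 1) * w * z)) (positive_power alpha))
    as [S [Y [hS0 [hY0 [hS [hY hpos]]]]]].
  { split.
    - intros z. apply (ex_derive_continuous (V := R_NormedModule)). auto_derive. exact I.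
    - intros z. apply (continuous_mult (K := R_AbsRing)); auto.
      apply (ex_derive_continuous (V := R_NormedModule)). auto_derive. exact I.
    - intros z. apply Rmult_lt_0_compat; auto. apply exp_pos.
    - intros z. apply Rmult_le_pos; auto. apply Rlt_le, exp_pos.
    - now apply sublinear_positive_power. }
  exists (fun z => exp (w * z) * S z), (fun z => - (exp (w * z) * Y z)).
  rewrite hS0, hY0. split; [ring |]. split; [ring |]. split; [| split].
  - intros z. pose proof (hS z) as h. auto_derive.
    + eexists; exact h.
    + replace (Derive (fun x : R => S x) z) with (Y z)
        by (symmetry; now apply is_derive_unique). ring.
  - intros z. pose proof (hY z) as h. auto_derive.
    + eexists; exact h.
    + replace (Derive (fun x : R => Y x) z)
        with (B * exp (- w * z) + a z * exp ((alpha - 1) * w * z)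
                                  * positive_power alpha (S z))
        by (symmetry; now apply is_derive_unique).
      rewrite positive_power_exp_mult.
      assert (e1 : exp (w * z) * exp (- w * z) = 1).
      { rewrite <- exp_plus, <- exp_0. f_equal. ring. }
      assert (e2 : exp (w * z) * exp ((alpha - 1) * w * z) = exp (alpha * (w * z))).
      { rewrite <- exp_plus. f_equal. ring. }
      rewrite <- e2.
      transitivity (- (w * exp (w * z) * Y z) - B * (exp (w * z) * exp (- w * z))
        - a z * (exp (w * z) * exp ((alpha - 1) * w * z) * positive_power alpha (S z))).
      * ring.
      * rewrite e1. ring.
  - intros z hz. apply Rmult_lt_0_compat; [apply exp_pos | auto].
Qed.

(** * Expansions at the origin *)

Lemma first_order_expansion (f : R -> R) (k : R) (hf : is_derive f 0 k) :
  is_domin (at_left 0) (fun z => Rabs z) (fun z => (f z - f 0) - k * z).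
Proof.
  destruct hf as [_ hf]. specialize (hf 0 (fun P HP => HP)).
  intros eps. apply filter_le_within. generalize (hf eps).
  apply filter_imp. intros z h.
  change (Rabs ((f z - f 0) - (z - 0) * k) <= eps * Rabs (z - 0)) in h.
  change (Rabs ((f z - f 0) - k * z) <= eps * Rabs (Rabs z)).
  rewrite Rabs_Rabsolu. rewrite Rminus_0_r in h.
  now rewrite (Rmult_comm k).
Qed.

(** Second-order Taylor expansion with a derivative that need only be
    differentiable at the base point. *)
Lemma second_order_expansion (f df : R -> R) (k : R)
  (hf : forall z, is_derive f z (df z)) (hf0 : f 0 = 0) (hdf0 : df 0 = 0)
  (hdf : is_derive df 0 k) :
  is_domin (at_left 0) (fun z => z ^ 2) (fun z => f z - k / 2 * z ^ 2).
Proof.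
  destruct hdf as [_ hdf]. specialize (hdf 0 (fun P HP => HP)).
  intros eps. apply filter_le_within. destruct (hdf eps) as [del hdel].
  exists del. intros z hz. assert (hz1 : Rabs (z - 0) < del) by exact hz.
  rewrite Rminus_0_r in hz1.
  change (Rabs (f z - k / 2 * z ^ 2) <= eps * Rabs (z ^ 2)).
  destruct (MVT_gen (fun x => f x - k / 2 * x ^ 2) 0 z (fun x => df x - k * x))
    as [x [hx e]].
  - intros x _. pose proof (hf x) as h. auto_derive.
    + eexists; exact h.
    + replace (Derive (fun x : R => f x) x) with (df x)
        by (symmetry; now apply is_derive_unique). field.
  - intros x _. apply continuity_pt_minus.
    + apply derivable_continuous_pt. exists (df x). now apply is_derive_Reals.
    + apply continuity_pt_filterlim.
      apply (ex_derive_continuous (V := R_NormedModule) (fun x => k / 2 * x ^ 2) x).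
      auto_derive. exact I.
  - rewrite hf0 in e. replace (f z - k / 2 * z ^ 2) with ((df x - k * x) * (z - 0)) by lra.
    assert (hxz : Rabs x <= Rabs z).
    { destruct (Rle_lt_dec 0 z) as [h | h].
      - rewrite Rmin_left, Rmax_right in hx by lra. rewrite !Rabs_pos_eq; lra.
      - rewrite Rmin_right, Rmax_left in hx by lra. rewrite !Rabs_left1; lra. }
    assert (hb : Rabs (x - 0) < del) by (rewrite Rminus_0_r; lra).
    specialize (hdel x hb).
    change (Rabs ((df x - df 0) - (x - 0) * k) <= eps * Rabs (x - 0)) in hdel.
    rewrite hdf0 in hdel. rewrite !Rminus_0_r in *.
    rewrite Rabs_mult, <- RPow_abs. simpl pow. rewrite Rmult_1_r, <- Rmult_assoc.
    apply Rmult_le_compat_r; [apply Rabs_pos |].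
    rewrite (Rmult_comm k). apply Rle_trans with (1 := hdel).
    apply Rmult_le_compat_l; auto. apply Rlt_le, cond_pos.
Qed.

(** * The change of time *)

(** A positive rate on [z < 0] is the derivative of a clock [tau] that can be
    read backwards; the inverse [h] is differentiable by the inverse function
    theorem in one variable. *)
Lemma time_change (rho : R -> R) (hpos : forall z, z < 0 -> 0 < rho z)
  (hcont : forall z, z < 0 -> continuous rho z) :
  exists tau h : R -> R, forall z, z < 0 ->
    is_derive tau z (rho z) /\ h (tau z) = z /\ is_derive h (tau z) (/ rho z).
Proof.
  set (tau := fun z => RInt rho (-1) z).
  assert (hd : forall z, z < 0 -> is_derive tau z (rho z)).
  { intros z hz. apply (is_derive_RInt rho tau (-1)); auto.
    assert (hl : 0 < - z) by lra.
    exists (mkposreal _ hl). intros x hx.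
    assert (hx1 : Rabs (x - z) < - z) by exact hx.
    apply Rabs_lt_between in hx1.
    apply (RInt_correct (V := R_CompleteNormedModule)).
    apply (ex_RInt_continuous (V := R_CompleteNormedModule)).
    intros y hy. apply hcont.
    pose proof (Rmax_lub_lt (-1) x 0 ltac:(lra) ltac:(lra)). lra. }
  assert (hc : forall z, z < 0 -> continuity_pt tau z).
  { intros z hz. apply derivable_continuous_pt. exists (rho z).
    apply is_derive_Reals. auto. }
  assert (hlt : forall a b, a < b -> b < 0 -> tau a < tau b).
  { intros a b hab hb.
    destruct (MVT_gen tau a b rho) as [x [hx e]];
      rewrite ?Rmin_left, ?Rmax_right in * by lra.
    - intros x hx. apply hd. lra.
    - intros x hx. apply hc. lra.
    - assert (0 < rho x * (b - a)); [| lra].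
      apply Rmult_lt_0_compat; [apply hpos |]; lra. }
  assert (hinj : forall a b, a < 0 -> b < 0 -> tau a = tau b -> a = b).
  { intros a b ha hb e. destruct (Rtotal_order a b) as [h | [h | h]]; auto;
      apply hlt in h; lra. }
  set (h := fun t => epsilon (inhabits 0) (fun z => z < 0 /\ tau z = t)).
  assert (hh : forall z, z < 0 -> h (tau z) = z).
  { intros z hz.
    assert (hs : h (tau z) < 0 /\ tau (h (tau z)) = tau z).
    { unfold h. apply epsilon_spec. now exists z. }
    apply hinj; tauto. }
  (* By the intermediate value theorem the values of [tau] near [z] fill a
     neighbourhood of [tau z]; with [hh] this makes [h] continuous there. *)
  assert (hnear : forall z (e : posreal), z < 0 -> locally (tau z) (fun t =>
            exists x, x < 0 /\ Rabs (x - z) < e /\ tau x = t)).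
  { intros z e hz. pose proof (cond_pos e) as he.
    set (m := Rmin (e / 2) (- z / 2)).
    assert (hm : 0 < m) by (apply Rmin_pos; lra).
    assert (hm1 : m <= e / 2) by apply Rmin_l.
    assert (hm2 : m <= - z / 2) by apply Rmin_r.
    assert (hl : tau (z - m) < tau z) by (apply hlt; lra).
    assert (hu : tau z < tau (z + m)) by (apply hlt; lra).
    assert (hr : 0 < Rmin (tau z - tau (z - m)) (tau (z + m) - tau z))
      by (apply Rmin_pos; lra).
    exists (mkposreal _ hr). intros t ht.
    assert (ht1 : Rabs (t - tau z) < Rmin (tau z - tau (z - m)) (tau (z + m) - tau z))
      by exact ht.
    apply Rabs_lt_between in ht1.
    pose proof (Rmin_l (tau z - tau (z - m)) (tau (z + m) - tau z)).
    pose proof (Rmin_r (tau z - tau (z - m)) (tau (z + m) - tau z)).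
    destruct (Ranalysis5.IVT_interv (fun x => tau x - t) (z - m) (z + m)) as [x [hx ex]];
      try lra.
    - intros x hx. apply continuity_pt_minus; [apply hc; lra |].
      apply continuity_pt_const. intros ? ?. reflexivity.
    - exists x. split; [lra |]. split; [apply Rabs_lt_between; lra | lra]. }
  exists tau, h. intros z hz. split; [auto |]. split; [auto |].
  split; [apply (is_linear_scal_l (K := R_AbsRing) (V := R_NormedModule)) |].
  intros t0 ht0.
  rewrite <- (is_filter_lim_locally_unique (V := R_NormedModule) _ _ ht0). clear t0 ht0.
  intros e. pose proof (cond_pos e) as he.
  pose proof (hpos z hz) as hr.
  set (e' := Rmin (rho z / 2) (e * (rho z * rho z) / 2)).
  assert (hrr : 0 < e * (rho z * rho z) / 2).
  { apply Rdiv_lt_0_compat; [| lra]. repeat apply Rmult_lt_0_compat; auto. }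
  assert (he' : 0 < e') by (apply Rmin_pos; lra).
  assert (he1 : e' <= rho z / 2) by apply Rmin_l.
  assert (he2 : e' <= e * (rho z * rho z) / 2) by apply Rmin_r.
  destruct (hd z hz) as [_ hdz].
  specialize (hdz z (fun P HP => HP) (mkposreal e' he')).
  destruct hdz as [del hdel].
  apply (filter_imp (F := locally (tau z))) with (2 := hnear z del hz).
  intros t [x [hx [hxz <-]]].
  specialize (hdel x hxz). rewrite (hh x hx), (hh z hz).
  change (Rabs ((tau x - tau z) - (x - z) * rho z) <= e' * Rabs (x - z)) in hdel.
  change (Rabs ((x - z) - (tau x - tau z) * / rho z) <= e * Rabs (tau x - tau z)).
  replace ((x - z) - (tau x - tau z) * / rho z)
    with (- / rho z * ((tau x - tau z) - (x - z) * rho z)) by (field; lra).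
  rewrite Rabs_mult, Rabs_Ropp, Rabs_pos_eq by (apply Rlt_le, Rinv_0_lt_compat; auto).
  set (Dt := tau x - tau z) in *. set (Dx := x - z) in *.
  assert (h1 : rho z / 2 * Rabs Dx <= Rabs Dt).
  { assert (h2 : Rabs (Dx * rho z) <= Rabs Dt + Rabs (Dt - Dx * rho z)).
    { replace (Dx * rho z) with (Dt + - (Dt - Dx * rho z)) by ring.
      apply Rle_trans with (1 := Rabs_triang _ _). rewrite Rabs_Ropp.
      replace (Dt + - (Dt - Dx * rho z)) with (Dx * rho z) by ring.
      apply Rle_refl. }
    rewrite Rabs_mult, (Rabs_pos_eq (rho z)) in h2 by lra.
    apply (Rmult_le_compat_r (Rabs Dx)) in he1; [lra | apply Rabs_pos]. }
  apply Rle_trans with (/ rho z * (e * (rho z * rho z) / 2 * Rabs Dx)).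
  - apply Rmult_le_compat_l; [apply Rlt_le, Rinv_0_lt_compat; auto |].
    apply Rle_trans with (1 := hdel).
    apply Rmult_le_compat_r; [apply Rabs_pos | auto].
  - replace (/ rho z * (e * (rho z * rho z) / 2 * Rabs Dx))
      with (e * (rho z / 2 * Rabs Dx)) by (field; lra).
    apply Rmult_le_compat_l; lra.
Qed.

(** * The trajectory in the conserved variables *)

Definition state_normed_module : NormedModule R_AbsRing :=
  prod_NormedModule R_AbsRing
    (prod_NormedModule R_AbsRing R_NormedModule R_NormedModule) R_NormedModule.

Lemma is_derive_state (f1 f2 f3 : R -> R) (t l1 l2 l3 : R)
  (h1 : is_derive f1 t l1) (h2 : is_derive f2 t l2) (h3 : is_derive f3 t l3) :
  is_derive (fun x => (f1 x, f2 x, f3 x) : state) t ((l1, l2, l3) : state).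
Proof.
  pose proof (is_derive_scal_l (V := state_normed_module) f1 t l1 (1, 0, 0) h1) as g1.
  pose proof (is_derive_scal_l (V := state_normed_module) f2 t l2 (0, 1, 0) h2) as g2.
  pose proof (is_derive_scal_l (V := state_normed_module) f3 t l3 (0, 0, 1) h3) as g3.
  pose proof (is_derive_plus _ _ _ _ _ (is_derive_plus _ _ _ _ _ g1 g2) g3) as g.
  assert (e : forall a b c : R,
    plus (plus (scal a ((1, 0, 0) : state)) (scal b ((0, 1, 0) : state)))
         (scal c ((0, 0, 1) : state)) = (a, b, c)).
  { intros a b c.
    change ((a * 1 + b * 0 + c * 0, a * 0 + b * 1 + c * 0, a * 0 + b * 0 + c * 1)
            = (a, b, c)).
    apply f_equal2; [apply f_equal2 |]; ring. }
  change (is_derive (fun x : R => plus (plus (scal (f1 x) ((1, 0, 0) : state))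
    (scal (f2 x) ((0, 1, 0) : state))) (scal (f3 x) ((0, 0, 1) : state))) t
    (plus (plus (scal l1 ((1, 0, 0) : state)) (scal l2 ((0, 1, 0) : state)))
         (scal l3 ((0, 0, 1) : state)))) in g.
  rewrite e in g.
  apply (is_derive_ext _ _ _ _ (fun x => e (f1 x) (f2 x) (f3 x)) g).
Qed.

Lemma moving_flux_conserved (A : R -> R) (alpha c rho u v : R) (hrho : rho <> 0) :
  moving_flux A alpha c (conserved rho u v) =
  (rho * (u - c), rho * u * (u - c) - A v * Rpower rho (- alpha), rho * v * (u - c)).
Proof.
  unfold moving_flux, flux, conserved.
  replace (rho * u / rho) with u by (field; auto).
  replace (rho * v / rho) with v by (field; auto).
  change ((rho * u + - (c * rho),
           rho * u ^ 2 - A v * Rpower rho (- alpha) + - (c * (rho * u)),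
           rho * u * v + - (c * (rho * v))) =
    (rho * (u - c), rho * u * (u - c) - A v * Rpower rho (- alpha), rho * v * (u - c))).
  apply f_equal2; [apply f_equal2 |]; ring.
Qed.

Lemma Rpower_inv_opp (x alpha : R) (hx : 0 < x) : Rpower (/ x) (- alpha) = Rpower x alpha.
Proof. unfold Rpower. f_equal. rewrite ln_Rinv by auto. ring. Qed.

Lemma continuous_pressure (p v : R) (hv : v < 1) :
  continuous (fun x => Rpower (1 - x) (- p)) v.
Proof.
  apply (ex_derive_continuous (V := R_NormedModule)). unfold Rpower. auto_derive. lra.
Qed.

Lemma relaxation_limit (w vL k : R) (hw : 0 < w) :
  is_lim (fun z => vL + k * exp (w * z)) m_infty vL.
Proof.
  replace (Finite vL) with (Finite (vL + k * 0)) by (f_equal; ring).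
  apply (is_lim_plus' (fun _ => vL)); [apply is_lim_const |].
  apply (is_lim_scal_l _ k m_infty 0).
  apply (is_lim_comp exp (fun z => w * z) m_infty 0 m_infty).
  - apply is_lim_exp_m.
  - apply is_lim_spec. intros M. exists (M / w). intros z hz.
    apply (Rmult_lt_compat_l w) in hz; auto.
    replace (w * (M / w)) with M in hz by (field; lra). exact hz.
  - exists 0. intros z _. discriminate.
Qed.

Theorem proposition1
  (alpha p : R) (halpha : 0 < alpha <= 1) (hp : 0 < p <= alpha)
  (A : R -> R) (hA : forall v : R, v < 1 -> A v = Rpower (1 - v) (- p))
  (rhoL uL vL : R) (hrhoL : 0 < rhoL)
  (rhoR uR vR : R) (hrhoR : 0 < rhoR)
  (c k1 k3 vdelta : R)
  (hk1 : k1 = c * (rhoR - rhoL) - (rhoR * uR - rhoL * uL))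
  (hk1_pos : 0 < k1)
  (hc : c * (rhoR * uR - rhoL * uL)
        - ((rhoR * uR ^ 2 - A vR * Rpower rhoR (- alpha))
           - (rhoL * uL ^ 2 - A vL * Rpower rhoL (- alpha))) = c * k1)
  (hk3 : k3 = c * (rhoR * vR - rhoL * vL) - (rhoR * uR * vR - rhoL * uL * vL))
  (hvdelta : vdelta = k3 / k1)
  (hvL : vL < 1) (hvdelta_lt : vdelta < 1)
  (hyL : 0 < uL - c)
  (BL : R) (hBL : BL = rhoL * (uL - c) ^ 2 - A vL / Rpower rhoL alpha)
  (hBL_pos : 0 < BL)
  (w1 w2 w3 : R)
  (hW : (w1, w2, w3) = moving_flux A alpha c (conserved rhoL uL vL))
  (GammaL : R) (hGammaL : GammaL = vdelta * w1 - w3) :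
  GammaL = rhoL * (uL - c) * (vdelta - vL) /\
  exists (H : R -> state) (tau rho u v : R -> R),
    (* H solves the system in the time tau, along tau = tau(zeta), zeta < 0,
       with dtau = rho dzeta; (rho, u, v)(zeta) are its primitive variables *)
    (forall zeta : R, zeta < 0 ->
       0 < rho zeta /\ v zeta < 1 /\
       is_derive tau zeta (rho zeta) /\
       H (tau zeta) = conserved (rho zeta) (u zeta) (v zeta) /\
       is_derive H (tau zeta)
         (reduced_field A alpha c (w1, w2, w3) (H (tau zeta)))) /\
    is_lim rho m_infty rhoL /\
    is_lim u m_infty uL /\
    is_lim v m_infty vL /\
    filterlim rho (at_left 0) (Rbar_locally p_infty) /\
    filterlim u (at_left 0) (locally c) /\
    filterlim v (at_left 0) (locally vdelta) /\
    is_domin (at_left 0) (fun zeta => Rabs zeta)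
      (fun zeta => (u zeta - c) - (- BL * zeta)) /\
    is_domin (at_left 0) (fun zeta => zeta ^ 2)
      (fun zeta => 1 / rho zeta - BL / 2 * zeta ^ 2) /\
    is_domin (at_left 0) (fun zeta => Rabs zeta)
      (fun zeta => (v zeta - vdelta) - GammaL * zeta).
Proof.
  rewrite moving_flux_conserved in hW by lra.
  injection hW as hw1 hw2 hw3.
  assert (hG : GammaL = w1 * (vdelta - vL)) by (rewrite hGammaL, hw1, hw3; ring).
  split; [rewrite hG, hw1; ring |].
  assert (hw : 0 < w1) by (rewrite hw1; now apply Rmult_lt_0_compat).
  set (v := fun z => vL + (vdelta - vL) * exp (w1 * z)).
  assert (hv1 : forall z, z <= 0 -> v z < 1).
  { intros z hz. unfold v.
    pose proof (exp_pos (w1 * z)) as h0.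
    assert (h1 : exp (w1 * z) <= 1).
    { rewrite <- exp_0. apply Rmult_le_compat_l with (r := w1) in hz; [| lra].
      rewrite Rmult_0_r in hz. destruct hz as [hz | ->]; [| lra].
      now apply Rlt_le, exp_increasing. }
    destruct h1 as [h1 | ->]; [| lra].
    assert (h2 : 0 < (1 - exp (w1 * z)) * (1 - vL)) by (apply Rmult_lt_0_compat; lra).
    assert (h3 : 0 < exp (w1 * z) * (1 - vdelta)) by (apply Rmult_lt_0_compat; lra).
    lra. }
  assert (dv : forall z, is_derive v z (w1 * (v z - vL))).
  { intros z. unfold v. auto_derive; [exact I | ring]. }
  assert (cv : forall z, continuous v z).
  { intros z. apply (ex_derive_continuous (V := R_NormedModule)). eexists. apply dv. }
  assert (hv0 : v 0 = vdelta) by (unfold v; rewrite Rmult_0_r, exp_0; ring).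
  assert (limv : is_lim v m_infty vL) by now apply relaxation_limit.
  (* Reflecting positive times keeps [v] below 1, so that the coefficient is
     defined and continuous on the whole line. *)
  set (a := fun z => Rpower (1 - v (- Rabs z)) (- p)).
  assert (ha : forall z, z < 0 -> a z = A (v z)).
  { intros z hz. unfold a. rewrite Rabs_left, Ropp_involutive by auto.
    symmetry. apply hA, hv1. lra. }
  assert (ca : forall z, continuous a z).
  { intros z. apply (continuous_comp (fun z => v (- Rabs z)) (fun x => Rpower (1 - x) (- p))).
    - apply (continuous_comp (fun z => - Rabs z) v); [| apply cv].
      apply (continuous_opp (V := R_NormedModule)). apply continuous_Rabs.
    - apply continuous_pressure, hv1. pose proof (Rabs_pos z). lra. }
  assert (hap : forall z, 0 <= a z) by (intros z; apply Rlt_le, exp_pos).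
  assert (lima : is_lim a m_infty (A vL)).
  { apply (is_lim_ext_loc (fun z => Rpower (1 - v z) (- p))).
    - exists 0. intros z hz. rewrite ha by auto. symmetry. apply hA, hv1. lra.
    - rewrite hA by auto.
      apply (filterlim_comp _ _ _ v (fun x => Rpower (1 - x) (- p)) _ (locally vL));
        [exact limv | now apply continuous_pressure]. }
  destruct (profile_exists alpha w1 BL halpha hBL_pos a ca hap)
    as [s [y [hs0 [hy0 [ds [dy hspos]]]]]].
  assert (hsL : 0 < / rhoL) by now apply Rinv_0_lt_compat.
  assert (hpow : positive_power alpha (/ rhoL) = Rpower rhoL (- alpha)).
  { rewrite positive_power_pos by auto.
    now rewrite <- (Rpower_inv_opp (/ rhoL)), Rinv_inv. }
  assert (hBL' : BL = w1 * (uL - c) - A vL * Rpower rhoL (- alpha)).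
  { rewrite hBL, hw1, Rpower_Ropp. unfold Rdiv. ring. }
  assert (haL : 0 <= A vL) by (rewrite hA by auto; apply Rlt_le, exp_pos).
  destruct (profile_limit (positive_power alpha) (sublinear_positive_power alpha halpha)
              w1 BL (A vL) (/ rhoL)) with (a := a) (s := s) (y := y) as [lims limy]; auto.
  { rewrite hpow, hBL', hw1. field. lra. }
  { intros z hz. apply hspos. lra. }
  set (rho := fun z => / s z). set (u := fun z => c + y z).
  assert (hrho : forall z, z < 0 -> 0 < rho z).
  { intros z hz. apply Rinv_0_lt_compat, hspos. lra. }
  assert (drho : forall z, z < 0 -> is_derive rho z (rho z * (rho z * (u z - c) - w1))).
  { intros z hz. pose proof (hspos z ltac:(lra)) as hsz.
    pose proof (is_derive_inv s z _ (ds z) ltac:(lra)) as h.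
    replace (rho z * (rho z * (u z - c) - w1)) with (- (w1 * s z - y z) / s z ^ 2);
      [exact h | unfold rho, u; field; lra]. }
  assert (du : forall z, is_derive u z (w1 * y z - BL - a z * positive_power alpha (s z))).
  { intros z. pose proof (dy z) as h. unfold u. auto_derive.
    - eexists; exact h.
    - replace (Derive (fun x : R => y x) z)
        with (w1 * y z - BL - a z * positive_power alpha (s z))
        by (symmetry; now apply is_derive_unique). ring. }
  destruct (time_change rho hrho) as [tau [h hh]].
  { intros z hz. apply (ex_derive_continuous (V := R_NormedModule)).
    eexists. now apply drho. }
  exists (fun t => conserved (rho (h t)) (u (h t)) (v (h t))), tau, rho, u, v.
  assert (left_lim : forall (f : R -> R) (l : R), continuous f 0 -> f 0 = l ->
            filterlim f (at_left 0) (locally l)).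
  { intros f l hf <- P hP. apply filter_le_within. exact (hf P hP). }
  assert (cs : continuous s 0).
  { apply (ex_derive_continuous (V := R_NormedModule)). eexists. apply ds. }
  assert (cu : continuous u 0).
  { apply (ex_derive_continuous (V := R_NormedModule)). eexists. apply du. }
  split.
  { intros zeta hz. destruct (hh zeta hz) as [dtau [e dh]].
    split; [now apply hrho |]. split; [apply hv1; lra |]. split; [exact dtau |].
    split; [now rewrite e |].
    pose proof (hrho zeta hz) as hr. pose proof (hspos zeta ltac:(lra)) as hsz.
    rewrite e. unfold reduced_field.
    rewrite moving_flux_conserved by lra.
    assert (chain : forall (f : R -> R) (df : R), is_derive f zeta df ->
              is_derive (fun t => f (h t)) (tau zeta) (/ rho zeta * df)).
    { intros f df hf. apply (is_derive_comp (V := R_NormedModule) f h (tau zeta) df); auto.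
      now rewrite e. }
    pose proof (chain rho _ (drho zeta hz)) as g1.
    pose proof (is_derive_mult _ _ _ _ _ g1 (chain u _ (du zeta)) Rmult_comm) as g2.
    pose proof (is_derive_mult _ _ _ _ _ g1 (chain v _ (dv zeta)) Rmult_comm) as g3.
    pose proof (is_derive_state _ _ _ _ _ _ _ g1 g2 g3) as g.
    match type of g with is_derive _ _ ?l => match goal with |- is_derive _ _ ?r =>
      replace r with l; [exact g |] end end.
    rewrite e.
    change ((/ rho zeta * (rho zeta * (rho zeta * (u zeta - c) - w1)),
      / rho zeta * (rho zeta * (rho zeta * (u zeta - c) - w1)) * u zeta
      + rho zeta * (/ rho zeta * (w1 * y zeta - BL - a zeta * positive_power alpha (s zeta))),
      / rho zeta * (rho zeta * (rho zeta * (u zeta - c) - w1)) * v zeta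
      + rho zeta * (/ rho zeta * (w1 * (v zeta - vL))))
      = (rho zeta * (u zeta - c) + - w1,
         rho zeta * u zeta * (u zeta - c) - A (v zeta) * Rpower (rho zeta) (- alpha) + - w2,
         rho zeta * v zeta * (u zeta - c) + - w3)).
    replace (Rpower (rho zeta) (- alpha)) with (positive_power alpha (s zeta)).
    2:{ rewrite positive_power_pos by auto. unfold rho. now rewrite Rpower_inv_opp. }
    rewrite ha by auto.
    (* Relative to the speed [c] the momentum constant is [BL]; this turns the momentum
       balance into the equation for [y]. *)
    assert (hw2' : w2 = w1 * c + BL) by (rewrite hw2, hBL', hw1; ring).
    assert (hw3' : w3 = w1 * vL) by (rewrite hw3, hw1; ring).
    assert (ey : y zeta = u zeta - c) by (unfold u; ring).
    rewrite hw2', hw3', ey.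
    apply f_equal2; [apply f_equal2 |]; field; lra. }
  split.
  { replace (Finite rhoL) with (Rbar_inv (/ rhoL)) by (simpl; now rewrite Rinv_inv).
    apply is_lim_inv; auto. intros e. injection e. lra. }
  split.
  { replace (Finite uL) with (Finite (c + w1 * / rhoL)).
    2:{ f_equal. rewrite hw1. field. lra. }
    apply (is_lim_plus' (fun _ => c)); auto. apply is_lim_const. }
  split.
  { exact limv. }
  split.
  { apply (filterlim_comp _ _ _ s Rinv _ (at_right 0)); [| apply filterlim_Rinv_0_right].
    pose proof (left_lim s 0 cs hs0) as hl.
    intros P [d hd]. generalize (hl _ (locally_ball 0 d)). unfold at_left, within, filtermap.
    apply filter_imp. intros z hz hz0. apply hd; [now apply hz |]. apply hspos. lra. }
  split.
  { apply left_lim; auto. unfold u. rewrite hy0. ring. }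
  split.
  { now apply left_lim. }
  split.
  { replace (fun zeta => u zeta - c - - BL * zeta)
      with (fun zeta => u zeta - u 0 - - BL * zeta).
    2:{ unfold u. rewrite hy0, Rplus_0_r. reflexivity. }
    apply first_order_expansion.
    replace (- BL) with (w1 * y 0 - BL - a 0 * positive_power alpha (s 0)); [apply du |].
    rewrite hs0, hy0, positive_power_nonpos by lra. ring. }
  split.
  { assert (ds0 : w1 * s 0 - y 0 = 0) by (rewrite hs0, hy0; ring).
    assert (dds : is_derive (fun z => w1 * s z - y z) 0 BL).
    { pose proof (ds 0) as h1. pose proof (dy 0) as h2. auto_derive.
      - split; [eexists; exact h1 |]. split; [eexists; exact h2 | exact I].
      - replace (Derive (fun x : R => s x) 0) with (w1 * s 0 - y 0)
          by (symmetry; now apply is_derive_unique).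
        replace (Derive (fun x : R => y x) 0)
          with (w1 * y 0 - BL - a 0 * positive_power alpha (s 0))
          by (symmetry; now apply is_derive_unique).
        rewrite hs0, hy0, positive_power_nonpos by lra. ring. }
    intros eps.
    apply (filter_imp (F := at_left 0))
      with (2 := second_order_expansion s _ BL ds hs0 ds0 dds eps).
    intros z hz. unfold rho. unfold Rdiv at 1. rewrite Rmult_1_l, Rinv_inv. exact hz. }
  rewrite <- hv0. apply first_order_expansion.
  replace GammaL with (w1 * (v 0 - vL)); [apply dv |]. now rewrite hv0, hG.
Qed.
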